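(* Let $H\neq0$ be a real constant and let $x:\Sigma\to\mathbb{I}^3$ be a conformal immersion of a simply connected domain $\Sigma\subset\mathbb{C}$ with constant mean curvature $H$, with orientation such that it admits an adapted frame in $\mathrm{SU}(1,0,1)$ (as defined in the context). Then locally, in the coordinates $(\mathbf{l},\mathbf{x},\mathbf{y})$ of $\mathbb{I}^3$ and up to a constant of integration, $x$ can be represented as $$x=\operatorname{Re}\int(\bar h_1+h_2,\,1,\,-i)\,\omega$$ for some holomorphic $h_1:\Sigma\to\mathbb{C}$, meromorphic $h_2:\Sigma\to\mathbb{C}$ and holomorphic $1$-form $\omega$ such that $h_2^2\omega$ is holomorphic while $$\mathrm{d}h_1=H\omega.$$ The metric of $x$ is then $$\mathrm{d}s^2=|\omega|^2,$$ the Hopf differential of $x$ is $$\tfrac12\,\omega\,\mathrm{d}h_2,$$ and, with $h:=\bar h_1+h_2$, the lightlike Gauss map $g:\Sigma\to\mathcal{L}$ of $x$ is $$g=-\tfrac12\left(1+|h|^2,\;2\operatorname{Re}h,\;-2\operatorname{Im}h,\;-1+|h|^2\right)^t.$$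
   Context: All maps are smooth. $\mathbb{L}^4$ is $\mathbb{R}^4$ with $\langle x,y\rangle=-x_0y_0+x_1y_1+x_2y_2+x_3y_3$, and $\mathcal{L}=\{y\in\mathbb{L}^4:\langle y,y\rangle=0\}$. With $\mathfrak{p}=(1,0,0,1)^t$, isotropic $3$-space is $\mathbb{I}^3=\{x\in\mathbb{L}^4:\langle x,\mathfrak{p}\rangle=0\}=\{(\mathbf{l},\mathbf{x},\mathbf{y},\mathbf{l})^t\}$ with induced metric $\mathrm{d}\mathbf{x}^2+\mathrm{d}\mathbf{y}^2$; a point $(\mathbf{l},\mathbf{x},\mathbf{y},\mathbf{l})^t$ is also written $(\mathbf{l},\mathbf{x},\mathbf{y})$. $\mathbb{L}^4$ is identified with $2\times2$ Hermitian matrices by $x\sim X=\begin{pmatrix}x_0+x_3&x_1+ix_2\\ x_1-ix_2&x_0-x_3\end{pmatrix}$. A conformal immersion $x:\Sigma\to\mathbb{I}^3$, with complex coordinate $z=u+iv$ on $\Sigma$, is an immersion whose induced metric is Riemannian and equals $e^{2\sigma}(\mathrm{d}u^2+\mathrm{d}v^2)=e^{2\sigma}\mathrm{d}z\,\mathrm{d}\bar z$ for some $\sigma:\Sigma\to\mathbb{R}$. Its lightlike Gauss map is the unique $g:\Sigma\to\mathcal{L}$ with $\langle g,\mathfrak{p}\rangle=1$ and $\langle\mathrm{d}x,g\rangle=0$. With $\partial_z=\tfrac12(\partial_u-i\partial_v)$, $\partial_{\bar z}=\tfrac12(\partial_u+i\partial_v)$, its mean curvature is $H=2e^{-2\sigma}\langle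 x_{z\bar z},g\rangle$ and its Hopf differential is the quadratic differential $\langle x_{zz},g\rangle\,\mathrm{d}z^2$. If $\omega=\phi\,\mathrm{d}z$, then $|\omega|^2=|\phi|^2\mathrm{d}z\,\mathrm{d}\bar z$ and $\omega\,\mathrm{d}h_2=\phi (h_2)_z\,\mathrm{d}z^2$. $\mathrm{SU}(1,0,1)=\left\{\begin{pmatrix}e^{i\theta}&w\\0&e^{-i\theta}\end{pmatrix}:\theta\in\mathbb{R},\,w\in\mathbb{C}\right\}$. An adapted frame of a conformal immersion (with matrix form $X$) is a map $F:\Sigma\to\mathrm{SU}(1,0,1)$ with $X_u=e^{\sigma}FE_1F^*$ and $X_v=e^{\sigma}FE_2F^*$, where $E_1=\begin{pmatrix}0&1\\1&0\end{pmatrix}$, $E_2=\begin{pmatrix}0&i\\-i&0\end{pmatrix}$ and $F^*$ is the conjugate transpose. (Having one means that $\mathbf{x}+i\mathbf{y}$ is holomorphic in $z$ along the immersion.) *)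

(* Defs.v *)
From Stdlib Require Export Reals.
From Coquelicot Require Export Coquelicot.

Open Scope R_scope.
Open Scope C_scope.

(* Maps on a domain D of the plane are total functions on Coquelicot's
   C = R * R, of which only the values on D matter; z = u + i v is (u, v).  *)

(** * Domains *)

Definition connected (D : C -> Prop) : Prop :=
  forall U V : C -> Prop, open U -> open V ->
    (forall z, D z -> U z \/ V z) ->
    (exists z, D z /\ U z) -> (exists z, D z /\ V z) ->
    exists z, D z /\ U z /\ V z.

Definition domain (D : C -> Prop) : Prop :=
  (exists z, D z) /\ open D /\ connected D.

Definition in_unit (t : R) : Prop := (0 <= t <= 1)%R.

(* Continuous maps on [0,1] and [0,1]^2 extend to R and R^2 by clamping the
   arguments, so asking for continuity everywhere loses no generality. *)
Definition simply_connected (D : C -> Prop) : Prop :=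
  forall c : R -> C,
    (forall t, continuous c t) ->
    (forall t, in_unit t -> D (c t)) ->
    c 0%R = c 1%R ->
    exists K : R * R -> C,
      (forall p, continuous K p) /\
      (forall s t, in_unit s -> in_unit t -> D (K (s, t))) /\
      (forall t, in_unit t -> K (0%R, t) = c t) /\
      (forall t, in_unit t -> K (1%R, t) = c 0%R) /\
      (forall s, in_unit s -> K (s, 0%R) = c 0%R /\ K (s, 1%R) = c 0%R).

(** * Partial derivatives and smoothness *)

Definition du (f : C -> R) (z : C) : R :=
  Derive (fun t : R => f (t, Im z)) (Re z).
Definition dv (f : C -> R) (z : C) : R :=
  Derive (fun t : R => f (Re z, t)) (Im z).

Definition duC (f : C -> C) (z : C) : C :=
  (du (fun w => Re (f w)) z, du (fun w => Im (f w)) z).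
Definition dvC (f : C -> C) (z : C) : C :=
  (dv (fun w => Re (f w)) z, dv (fun w => Im (f w)) z).

Definition dz (f : C -> C) (z : C) : C := / 2 * (duC f z - Ci * dvC f z).
Definition dzbar (f : C -> C) (z : C) : C := / 2 * (duC f z + Ci * dvC f z).

Definition smooth (D : C -> Prop) (f : C -> R) : Prop :=
  forall z, D z -> forall n : nat,
    ex_diff_n (fun u v : R => f (u, v)) n (Re z) (Im z).
Definition smoothC (D : C -> Prop) (f : C -> C) : Prop :=
  smooth D (fun z => Re (f z)) /\ smooth D (fun z => Im (f z)).

(** * Minkowski space and isotropic space *)

Record vec4 (T : Type) : Type := Vec4 { x0 : T; x1 : T; x2 : T; x3 : T }.
Arguments Vec4 {T}.
Arguments x0 {T}.
Arguments x1 {T}.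
Arguments x2 {T}.
Arguments x3 {T}.

Definition L4 : Type := vec4 R.

Definition lor (x y : L4) : R :=
  (- (x0 x * x0 y) + x1 x * x1 y + x2 x * x2 y + x3 x * x3 y)%R.

(* The complex bilinear (not Hermitian) extension of [lor]. *)
Definition lorC (x y : vec4 C) : C :=
  - (x0 x * x0 y) + x1 x * x1 y + x2 x * x2 y + x3 x * x3 y.

Definition toC (x : L4) : vec4 C :=
  Vec4 (RtoC (x0 x)) (RtoC (x1 x)) (RtoC (x2 x)) (RtoC (x3 x)).

Definition lightcone (y : L4) : Prop := lor y y = 0%R.

Definition frakp : L4 := Vec4 1%R 0%R 0%R 1%R.

Definition isotropic3 (x : L4) : Prop := lor x frakp = 0%R.

(* The differential operator P applied to each component of x. *)
Definition vmap {T U : Type} (P : (C -> T) -> C -> U)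
    (x : C -> vec4 T) (z : C) : vec4 U :=
  Vec4 (P (fun w => x0 (x w)) z) (P (fun w => x1 (x w)) z)
       (P (fun w => x2 (x w)) z) (P (fun w => x3 (x w)) z).

Definition smooth4 (D : C -> Prop) (x : C -> L4) : Prop :=
  smooth D (fun z => x0 (x z)) /\ smooth D (fun z => x1 (x z)) /\
  smooth D (fun z => x2 (x z)) /\ smooth D (fun z => x3 (x z)).

Definition lincomb (a b : R) (x y : L4) : L4 :=
  Vec4 (a * x0 x + b * x0 y)%R (a * x1 x + b * x1 y)%R
       (a * x2 x + b * x2 y)%R (a * x3 x + b * x3 y)%R.

(** * Conformal immersions, lightlike Gauss maps and curvature *)

Definition immersion (D : C -> Prop) (x : C -> L4) : Prop :=
  forall z, D z -> forall a b : R,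
    lincomb a b (vmap du x z) (vmap dv x z) = Vec4 0%R 0%R 0%R 0%R ->
    a = 0%R /\ b = 0%R.

(* The metric induced by x on D is lambda (du^2 + dv^2). *)
Definition induced_metric (D : C -> Prop) (x : C -> L4) (lambda : C -> R)
    : Prop :=
  forall z, D z ->
    lor (vmap du x z) (vmap du x z) = lambda z /\
    lor (vmap du x z) (vmap dv x z) = 0%R /\
    lor (vmap dv x z) (vmap dv x z) = lambda z.

Definition conformal_immersion (D : C -> Prop) (x : C -> L4) (sigma : C -> R)
    : Prop :=
  smooth4 D x /\ smooth D sigma /\
  (forall z, D z -> isotropic3 (x z)) /\
  immersion D x /\
  induced_metric D x (fun z => exp (2 * sigma z)).

Definition lightlike_gauss_map (D : C -> Prop) (x g : C -> L4) : Prop :=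
  smooth4 D g /\
  forall z, D z ->
    lightcone (g z) /\ lor (g z) frakp = 1%R /\
    lor (vmap du x z) (g z) = 0%R /\ lor (vmap dv x z) (g z) = 0%R.

Definition mean_curvature (x : C -> L4) (sigma : C -> R) (g : C -> L4) (z : C)
    : C :=
  2 * RtoC (exp (- 2 * sigma z)) *
  lorC (vmap dzbar (vmap dz (fun w => toC (x w))) z) (toC (g z)).

(* The coefficient of dz^2 in the Hopf differential. *)
Definition hopf (x g : C -> L4) (z : C) : C :=
  lorC (vmap dz (vmap dz (fun w => toC (x w))) z) (toC (g z)).

(** * Adapted frames *)

Definition mat2 : Type := @matrix C 2 2.

Definition entry (A : mat2) (i j : nat) : C := coeff_mat (RtoC 0) A i j.

Definition hermitian (x : L4) : mat2 :=
  [[RtoC (x0 x + x3 x), (x1 x, x2 x)],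
   [(x1 x, (- x2 x)%R), RtoC (x0 x - x3 x)]].

Definition adjoint (A : mat2) : mat2 :=
  mk_matrix 2 2 (fun i j => Cconj (entry A j i)).

Definition mscal (c : C) (A : mat2) : mat2 :=
  mk_matrix 2 2 (fun i j => c * entry A i j).

Definition mmap (P : (C -> C) -> C -> C) (A : C -> mat2) (z : C) : mat2 :=
  mk_matrix 2 2 (fun i j => P (fun w => entry (A w) i j) z).

Definition mmul (A B : mat2) : mat2 := Mmult (T := C_Ring) A B.

Definition SU101 (A : mat2) : Prop :=
  exists (theta : R) (w : C),
    A = [[(cos theta, sin theta), w],
         [RtoC 0, (cos theta, (- sin theta)%R)]].

Definition E1 : mat2 := [[RtoC 0, RtoC 1], [RtoC 1, RtoC 0]].
Definition E2 : mat2 := [[RtoC 0, Ci], [- Ci, RtoC 0]].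

Definition adapted_frame (D : C -> Prop) (x : C -> L4) (sigma : C -> R)
    (F : C -> mat2) : Prop :=
  (forall i j : nat, (i < 2)%nat -> (j < 2)%nat ->
     smoothC D (fun z => entry (F z) i j)) /\
  forall z, D z ->
    SU101 (F z) /\
    mmap duC (fun w => hermitian (x w)) z =
      mscal (RtoC (exp (sigma z))) (mmul (mmul (F z) E1) (adjoint (F z))) /\
    mmap dvC (fun w => hermitian (x w)) z =
      mscal (RtoC (exp (sigma z))) (mmul (mmul (F z) E2) (adjoint (F z))).

(** * Holomorphic and meromorphic functions *)

Definition complex_derivative (f : C -> C) (z l : C) : Prop :=
  is_derive (K := C_AbsRing) (V := C_NormedModule) f z l.

Definition holomorphic (D : C -> Prop) (f : C -> C) : Prop :=
  forall z, D z -> exists l, complex_derivative f z l.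

Definition holomorphic_at (f : C -> C) (p : C) : Prop :=
  locally p (fun z => exists l, complex_derivative f z l).

(* The value f p at a pole p is irrelevant. *)
Definition pole (f : C -> C) (p : C) : Prop :=
  locally' p (fun z => exists l, complex_derivative f z l) /\
  filterlim (fun z => Cmod (f z)) (locally' p) (Rbar_locally p_infty).

Definition meromorphic (D : C -> Prop) (f : C -> C) : Prop :=
  forall p, D p -> holomorphic_at f p \/ pole f p.

(* f is holomorphic on D after removing its singularities at points of P. *)
Definition extends_holomorphically (D P : C -> Prop) (f : C -> C) : Prop :=
  exists q : C -> C,
    holomorphic D q /\ forall z, D z -> ~ P z -> q z = f z.

(** * Line integrals *)

Definition C1_path (c dc : R -> C) : Prop :=
  forall t, in_unit t ->
    is_derive (K := R_AbsRing) (V := C_R_NormedModule) c t (dc t) /\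
    continuous dc t.

(* J is the integral of psi dz along the path c with velocity dc. *)
Definition is_line_integral (psi : C -> C) (c dc : R -> C) (J : C) : Prop :=
  is_RInt (V := C_R_NormedModule) (fun t : R => psi (c t) * dc t) 0 1 J.

(* Main.v *)
Require Import Defs.
From Stdlib Require Import Lra.

(** Write x = (l, X, Y, l).  The off-diagonal entry of the frame equations
    says that Z = X + i Y is holomorphic, so phi = Z' is holomorphic, and
    conformality reads |phi|^2 = e^(2 sigma).

    The whole representation is carried by one function, the coordinate
    h = - g1 + i g2 of the Gauss map.  Since g is lightlike and normalised
    against the null direction, g is the stated quadratic expression in h,
    and the two orthogonality relations <dx, g> = 0 amount to the single
    complex equation 2 l_z = h phi ([gauss_coordinate_mul]).  Together with
    2 X_z = phi and 2 Y_z = - i phi this is the integral formula, because the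
    real part of (2 f_z) dz is df for every real function f
    ([smooth_line_integral]).

    Now differentiate 2 l_z = h phi.  As X and Y are harmonic, and as
    <(1,0,0,1), g> = 1, only l contributes to <x_zzbar, g>, and constant mean
    curvature says exactly 2 l_zzbar = H phi conj(phi), that is
    h_zbar = H conj(phi).  But the antiholomorphic function conj(H Z) has the
    same zbar-derivative, so h1 = H Z and h2 = h - conj(h1) are holomorphic;
    in particular h2 has no poles here, and the representation holds on all
    of D.  Finally <x_zz, g> = l_zz - h phi' / 2 = h_z phi / 2, which is the
    Hopf differential.

    All of this is done with a small calculus of Wirtinger derivatives of
    real-differentiable functions ([wirtinger]), whose only link with complex
    differentiability is [wirtinger_complex_derivative]. *)

(** * Smooth functions of two real variables *)

Lemma smooth_du (D : C -> Prop) (f : C -> R) : smooth D f -> smooth D (du f).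
Proof. intros Hf z Dz n. exact (proj1 (proj2 (proj2 (proj2 (Hf z Dz (S n)))))). Qed.

Lemma smooth_dv (D : C -> Prop) (f : C -> R) : smooth D f -> smooth D (dv f).
Proof. intros Hf z Dz n. exact (proj2 (proj2 (proj2 (proj2 (Hf z Dz (S n)))))). Qed.

Lemma smooth_continuity_2d (D : C -> Prop) (f : C -> R) (z : C) :
  smooth D f -> D z -> continuity_2d_pt (fun u v => f (u, v)) (Re z) (Im z).
Proof. intros Hf Dz. exact (proj1 (Hf z Dz 0%nat)). Qed.

Lemma smooth_ex_derive (D : C -> Prop) (f : C -> R) (z : C) :
  smooth D f -> D z ->
  ex_derive (fun t => f (t, Im z)) (Re z) /\ ex_derive (fun t => f (Re z, t)) (Im z).
Proof. intros Hf Dz. destruct (Hf z Dz 1%nat) as (_ & H1 & H2 & _). now split. Qed.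

Lemma open_locally_2d (D P : C -> Prop) (z : C) :
  open D -> D z -> (forall w, D w -> P w) ->
  locally_2d (fun u v => P (u, v)) (Re z) (Im z).
Proof.
  intros Do Dz HP. apply locally_2d_locally.
  destruct z as [u v]. generalize (Do _ Dz). apply filter_imp.
  intros [a b] Dw. now apply HP.
Qed.

Lemma smooth_schwarz (D : C -> Prop) (f : C -> R) (z : C) :
  open D -> smooth D f -> D z -> du (dv f) z = dv (du f) z.
Proof.
  intros Do Hf Dz.
  apply (Schwarz (fun u v => f (u, v)) (Re z) (Im z)).
  - apply (open_locally_2d D (fun w =>
      ex_derive (fun t => f (t, Im w)) (Re w) /\
      ex_derive (fun t => f (Re w, t)) (Im w) /\
      ex_derive (fun t => dv f (t, Im w)) (Re w) /\
      ex_derive (fun t => du f (Re w, t)) (Im w))); auto.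
    intros w Dw. repeat split.
    + now apply (smooth_ex_derive D).
    + now apply (smooth_ex_derive D).
    + apply (smooth_ex_derive D); auto using smooth_dv.
    + apply (smooth_ex_derive D); auto using smooth_du.
  - apply (smooth_continuity_2d D (du (dv f))); auto using smooth_du, smooth_dv.
  - apply (smooth_continuity_2d D (dv (du f))); auto using smooth_du, smooth_dv.
Qed.

(** Real (Frechet) differentiability, not mere existence of the partials: the
    chain rule along paths and complex differentiability depend on it. *)
Definition pdiff (f : C -> R) (z : C) (a b : R) : Prop :=
  differentiable_pt_lim (fun u v => f (u, v)) (Re z) (Im z) a b.

Lemma smooth_pdiff (D : C -> Prop) (f : C -> R) (z : C) :
  open D -> smooth D f -> D z -> pdiff f z (du f z) (dv f z).
Proof.
  intros Do Hf Dz. apply filterdiff_differentiable_pt_lim.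
  refine (filterdiff_ext_lin _ _ _ (is_derive_filterdiff (fun u v => f (u, v))
    (Re z) (Im z) (fun u v => du f (u, v)) (dv f z) _ _ _) _).
  - apply (proj1 (locally_2d_locally (fun u v =>
      is_derive (fun t => f (t, v)) u (du f (u, v))) (Re z) (Im z))).
    apply (open_locally_2d D (fun w =>
      is_derive (fun t => f (t, Im w)) (Re w) (du f w))); auto.
    intros w Dw. apply Derive_correct. now apply (smooth_ex_derive D).
  - apply Derive_correct. now apply (smooth_ex_derive D).
  - apply (proj1 (continuity_2d_pt_filterlim (fun u v => du f (u, v)) (Re z) (Im z))).
    apply (smooth_continuity_2d D (du f)); auto using smooth_du.
  - intros y. destruct z. reflexivity.
Qed.

Lemma pdiff_unique (f : C -> R) (z : C) (a b : R) :
  pdiff f z a b -> du f z = a /\ dv f z = b.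
Proof. intros Hf. exact (differentiable_pt_lim_unique _ _ _ _ _ Hf). Qed.

Lemma pdiff_ext (D : C -> Prop) (f g : C -> R) (z : C) (a b : R) :
  open D -> D z -> (forall w, D w -> f w = g w) -> pdiff f z a b -> pdiff g z a b.
Proof.
  intros Do Dz Hfg. apply differentiable_pt_lim_ext.
  apply (open_locally_2d D (fun w => f w = g w)); auto.
Qed.

Lemma pdiff_eq (f : C -> R) (z : C) (a b a' b' : R) :
  pdiff f z a b -> a = a' -> b = b' -> pdiff f z a' b'.
Proof. now intros Hf <- <-. Qed.

Lemma pdiff_const (k : R) (z : C) : pdiff (fun _ => k) z 0%R 0%R.
Proof.
  apply filterdiff_differentiable_pt_lim.
  apply (filterdiff_ext_lin _ (fun _ => zero)).
  - apply filterdiff_const.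
  - intros y. unfold zero; simpl. ring.
Qed.

Lemma pdiff_plus (f g : C -> R) (z : C) (a b a' b' : R) :
  pdiff f z a b -> pdiff g z a' b' ->
  pdiff (fun w => f w + g w)%R z (a + a')%R (b + b')%R.
Proof.
  intros Hf Hg. apply filterdiff_differentiable_pt_lim in Hf, Hg.
  apply filterdiff_differentiable_pt_lim.
  refine (filterdiff_ext_lin _ _ _ (filterdiff_plus_fct _ _ _ _ Hf Hg) _).
  intros y. unfold plus; simpl. ring.
Qed.

Lemma pdiff_mult (f g : C -> R) (z : C) (a b a' b' : R) :
  pdiff f z a b -> pdiff g z a' b' ->
  pdiff (fun w => f w * g w)%R z (a * g z + f z * a')%R (b * g z + f z * b')%R.
Proof.
  intros Hf Hg. apply filterdiff_differentiable_pt_lim in Hf, Hg.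
  apply filterdiff_differentiable_pt_lim.
  refine (filterdiff_ext_lin _ _ _ (filterdiff_mult_fct _ _ _ _ _ Rmult_comm Hf Hg) _).
  intros y. destruct z. unfold plus, mult; simpl. ring.
Qed.

(** * Wirtinger derivatives *)

(** f is real-differentiable at z with df = a dz + b dzbar; the four partial
    derivatives are read off from f_u = a + b and f_v = i (a - b). *)
Definition wirtinger (f : C -> C) (z a b : C) : Prop :=
  pdiff (fun w => Re (f w)) z (Re a + Re b)%R (Im b - Im a)%R /\
  pdiff (fun w => Im (f w)) z (Im a + Im b)%R (Re a - Re b)%R.

Ltac destC := repeat match goal with z : C |- _ => destruct z as [? ?] end.

Lemma C_half : / 2 = ((/ 2)%R, 0%R) :> C.
Proof. rewrite <- RtoC_inv; [reflexivity | lra]. Qed.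

Lemma wirtinger_unique (f : C -> C) (z a b : C) :
  wirtinger f z a b -> dz f z = a /\ dzbar f z = b.
Proof.
  intros [Hr Hi]. apply pdiff_unique in Hr, Hi.
  unfold dz, dzbar, duC, dvC. rewrite (proj1 Hr), (proj1 Hi), (proj2 Hr), (proj2 Hi), C_half.
  destC. split; apply injective_projections; simpl; field.
Qed.

Lemma smooth_wirtinger (D : C -> Prop) (f : C -> C) (z : C) :
  open D -> smoothC D f -> D z -> wirtinger f z (dz f z) (dzbar f z).
Proof.
  intros Do [Hr Hi] Dz.
  split; (eapply pdiff_eq; [apply (smooth_pdiff D); assumption | |]);
    unfold dz, dzbar, duC, dvC; rewrite C_half; simpl; field.
Qed.

Lemma wirtinger_eq (f : C -> C) (z a b a' b' : C) :
  wirtinger f z a b -> a = a' -> b = b' -> wirtinger f z a' b'.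
Proof. now intros Hf <- <-. Qed.

Lemma wirtinger_ext (D : C -> Prop) (f g : C -> C) (z a b : C) :
  open D -> D z -> (forall w, D w -> f w = g w) ->
  wirtinger f z a b -> wirtinger g z a b.
Proof.
  intros Do Dz Hfg [Hr Hi].
  split; eapply (pdiff_ext D); try eassumption; intros w Dw; simpl; now rewrite Hfg.
Qed.

Lemma wirtinger_const (k z : C) : wirtinger (fun _ => k) z 0 0.
Proof. split; eapply pdiff_eq; try apply pdiff_const; simpl; ring. Qed.

Lemma wirtinger_conj (f : C -> C) (z a b : C) :
  wirtinger f z a b -> wirtinger (fun w => Cconj (f w)) z (Cconj b) (Cconj a).
Proof.
  intros [Hr Hi]. split.
  - eapply pdiff_eq; [exact Hr | |]; destC; simpl; ring.
  - apply (pdiff_ext (fun _ => True) (fun w => (-1) * Im (f w))%R); auto using open_true.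
    + intros w _. destruct (f w). simpl. ring.
    + eapply pdiff_eq; [apply pdiff_mult; [apply pdiff_const | exact Hi] | |];
      destC; simpl; ring.
Qed.

Lemma wirtinger_plus (f g : C -> C) (z a b a' b' : C) :
  wirtinger f z a b -> wirtinger g z a' b' ->
  wirtinger (fun w => f w + g w) z (a + a') (b + b').
Proof.
  intros [Hr Hi] [Hr' Hi'].
  split; (eapply pdiff_eq; [apply pdiff_plus; eassumption | |]); destC; simpl; ring.
Qed.

Lemma wirtinger_mult (f g : C -> C) (z a b a' b' : C) :
  wirtinger f z a b -> wirtinger g z a' b' ->
  wirtinger (fun w => f w * g w) z (a * g z + f z * a') (b * g z + f z * b').
Proof.
  intros [Hr Hi] [Hr' Hi']. split.
  - apply (pdiff_ext (fun _ => True)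
      (fun w => Re (f w) * Re (g w) + (-1) * (Im (f w) * Im (g w)))%R);
      auto using open_true.
    + intros w _. destruct (f w), (g w). simpl. ring.
    + eapply pdiff_eq; [repeat (eassumption || apply pdiff_plus || apply pdiff_mult
        || apply pdiff_const) | |]; unfold Re, Im; simpl; ring.
  - apply (pdiff_ext (fun _ => True)
      (fun w => Re (f w) * Im (g w) + Im (f w) * Re (g w))%R);
      auto using open_true.
    eapply pdiff_eq; [repeat (eassumption || apply pdiff_plus || apply pdiff_mult
        || apply pdiff_const) | |]; unfold Re, Im; simpl; ring.
Qed.

Lemma wirtinger_scal (k : C) (f : C -> C) (z a b : C) :
  wirtinger f z a b -> wirtinger (fun w => k * f w) z (k * a) (k * b).
Proof.
  intros Hf. eapply wirtinger_eq;
    [apply wirtinger_mult; [apply wirtinger_const | exact Hf] | |]; cbv beta; ring.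
Qed.

Lemma wirtinger_opp (f : C -> C) (z a b : C) :
  wirtinger f z a b -> wirtinger (fun w => - f w) z (- a) (- b).
Proof.
  intros Hf. apply (wirtinger_ext (fun _ => True) (fun w => RtoC (-1) * f w));
    auto using open_true.
  - intros w _. apply injective_projections; simpl; ring.
  - eapply wirtinger_eq; [now apply wirtinger_scal, Hf | |];
      apply injective_projections; simpl; ring.
Qed.

(** With b = 0 the real differential is multiplication by a.  The two notions
    of differentiability measure errors differently, by the maximum of the
    coordinates and by the modulus; the factor between these is at most 2,
    whence the eps / 2 below. *)
Lemma wirtinger_complex_derivative (f : C -> C) (z a : C) :
  wirtinger f z a 0 -> complex_derivative f z a.
Proof.
  intros [Hr Hi]. split; [apply is_linear_scal_l|].
  intros y Hy.
  apply (is_filter_lim_locally_unique (V := AbsRing_NormedModule C_AbsRing)) in Hy.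
  subst y. intros eps. apply (proj1 (locally_C z _)).
  assert (He : (0 < eps / 2)%R) by (generalize (cond_pos eps); lra).
  specialize (Hr (mkposreal _ He)). specialize (Hi (mkposreal _ He)).
  generalize (locally_2d_and _ _ _ _ Hr Hi). rewrite locally_2d_locally.
  destruct z as [u v]. apply filter_imp. clear Hr Hi.
  intros [u' v'] [Kr Ki]. simpl in Kr, Ki.
  change (Cmod (f (u', v') - f (u, v) - ((u', v') - (u, v)) * a)
    <= eps * Cmod ((u', v') - (u, v)))%R.
  eapply Rle_trans; [apply Cmod_2Rmax|].
  assert (M : (Rmax (Rabs (u' - u)) (Rabs (v' - v)) <= Cmod ((u', v') - (u, v)))%R)
    by exact (Rmax_Cmod ((u', v') - (u, v))).
  assert (S2 : (0 <= sqrt 2 <= 2)%R).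
  { split; [apply sqrt_pos|]. apply Rsqr_incr_0_var; [|lra].
    rewrite Rsqr_sqrt; unfold Rsqr; lra. }
  assert (K : (Rmax (Rabs (fst (f (u', v') - f (u, v) - ((u', v') - (u, v)) * a)%C))
    (Rabs (snd (f (u', v') - f (u, v) - ((u', v') - (u, v)) * a)%C))
    <= eps / 2 * Cmod ((u', v') - (u, v)))%R).
  { apply Rmax_lub.
    - eapply Rle_trans; [| apply Rmult_le_compat_l; [lra | exact M]].
      eapply Rle_trans; [| exact Kr]. right. f_equal.
      unfold Re, Im; simpl; ring.
    - eapply Rle_trans; [| apply Rmult_le_compat_l; [lra | exact M]].
      eapply Rle_trans; [| exact Ki]. right. f_equal.
      unfold Re, Im; simpl; ring. }
  assert (N := Cmod_ge_0 ((u', v') - (u, v))).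
  eapply Rle_trans; [apply Rmult_le_compat_l; [apply S2 | exact K]|].
  assert (0 <= eps / 2 * Cmod ((u', v') - (u, v)))%R by (apply Rmult_le_pos; lra).
  nra.
Qed.

Lemma dz_RtoC (f : C -> R) (z : C) :
  dz (fun w => RtoC (f w)) z = / 2 * (du f z, (- dv f z)%R).
Proof.
  unfold dz, duC, dvC. rewrite C_half.
  unfold du at 2, dv at 2; cbn [Im Re RtoC fst snd]. rewrite !Derive_const.
  change (fun w => f w) with f.
  apply injective_projections; simpl; ring.
Qed.

(** * Integrals of real differentials along paths *)

(** If psi = 2 f_z = f_u - i f_v, then psi dz has real part
    f_u du + f_v dv = df, which integrates to the difference of end values;
    the imaginary part is integrable by continuity alone. *)
Lemma smooth_line_integral (D : C -> Prop) (f : C -> R) (psi : C -> C) (c dc : R -> C) :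
  open D -> smooth D f ->
  (forall z, D z -> dz (fun w => RtoC (f w)) z = / 2 * psi z) ->
  C1_path c dc -> (forall t, in_unit t -> D (c t)) ->
  exists J, is_line_integral psi c dc J /\ (f (c 1) - f (c 0))%R = Re J.
Proof.
  intros Do Hf Hpsi Hc HD.
  assert (unit_bounds : forall t, (Rmin 0 1 <= t <= Rmax 0 1)%R -> in_unit t).
  { intros t. rewrite Rmin_left, Rmax_right by lra. auto. }
  assert (comp : forall k : C -> R, smooth D k -> forall t, in_unit t ->
    continuous (fun s => k (c s)) t).
  { intros k Hk t Ht. apply (continuous_comp c k).
    - apply (ex_derive_continuous (K := R_AbsRing) (V := C_R_NormedModule)).
      exists (dc t). apply (Hc t Ht).
    - generalize (proj1 (continuity_2d_pt_filterlim (fun u v => k (u, v)) _ _)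
        (smooth_continuity_2d D k (c t) Hk (HD t Ht))).
      unfold continuous. destruct (c t) as [u v]. apply filterlim_ext.
      now intros [p q]. }
  assert (dcr : forall t, in_unit t -> continuous (fun s => Re (dc s)) t).
  { intros t Ht. apply (continuous_comp dc fst); [apply (Hc t Ht) | apply continuous_fst]. }
  assert (dci : forall t, in_unit t -> continuous (fun s => Im (dc s)) t).
  { intros t Ht. apply (continuous_comp dc snd); [apply (Hc t Ht) | apply continuous_snd]. }
  set (re := fun t => (du f (c t) * Re (dc t) + dv f (c t) * Im (dc t))%R).
  set (im := fun t => (du f (c t) * Im (dc t) - dv f (c t) * Re (dc t))%R).
  assert (Ire : is_RInt re 0 1 (f (c 1) - f (c 0))%R).
  { apply (is_RInt_derive (V := R_CompleteNormedModule) (fun t => f (c t)) re).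
    - intros t Ht%unit_bounds. destruct (Hc t Ht) as [dct _].
      apply is_derive_Reals.
      apply (derivable_pt_lim_ext (fun s => f (Re (c s), Im (c s)))).
      { intros s. now destruct (c s). }
      apply (derivable_pt_lim_comp_2d (fun u v => f (u, v))).
      + apply (smooth_pdiff D); auto.
      + apply is_derive_Reals.
        apply (filterdiff_comp' c fst _ _ _ dct (filterdiff_linear _ is_linear_fst)).
      + apply is_derive_Reals.
        apply (filterdiff_comp' c snd _ _ _ dct (filterdiff_linear _ is_linear_snd)).
    - intros t Ht%unit_bounds.
      apply (continuous_plus (V := R_NormedModule));
        apply (continuous_mult (K := R_AbsRing)); auto using smooth_du, smooth_dv. }
  assert (Iim : ex_RInt im 0 1).
  { apply (ex_RInt_continuous (V := R_CompleteNormedModule)).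
    intros t Ht%unit_bounds.
    apply (continuous_minus (V := R_NormedModule));
      apply (continuous_mult (K := R_AbsRing)); auto using smooth_du, smooth_dv. }
  destruct Iim as [b Iim].
  exists ((f (c 1) - f (c 0))%R, b). split; [|reflexivity].
  apply (is_RInt_ext (V := C_R_NormedModule) (fun t => (re t, im t))).
  - intros t Ht.
    assert (Ht' : in_unit t) by (apply unit_bounds; lra).
    assert (E : psi (c t) = (du f (c t), (- dv f (c t))%R)).
    { specialize (Hpsi _ (HD t Ht')). rewrite dz_RtoC, C_half in Hpsi.
      destruct (psi (c t)) as [p q]. injection Hpsi as Hp Hq.
      apply injective_projections; simpl; lra. }
    rewrite E. unfold re, im, Re, Im. apply injective_projections; simpl; ring.
  - apply (is_RInt_fct_extend_pair (U := R_NormedModule) (V := R_NormedModule)); assumption.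
Qed.

(** * Cauchy-Riemann equations *)

Lemma entry_mmul (A B : mat2) (i j : nat) :
  (i < 2)%nat -> (j < 2)%nat ->
  entry (mmul A B) i j = entry A i 0 * entry B 0 j + entry A i 1 * entry B 1 j.
Proof.
  intros Hi Hj. unfold mmul, Mmult, entry. rewrite coeff_mat_bij by assumption.
  simpl pred. rewrite sum_Sn, sum_O. reflexivity.
Qed.

Lemma entry_mscal (c : C) (A : mat2) (i j : nat) :
  (i < 2)%nat -> (j < 2)%nat -> entry (mscal c A) i j = c * entry A i j.
Proof. intros Hi Hj. unfold mscal, entry at 1. now rewrite coeff_mat_bij. Qed.

Lemma entry_adjoint (A : mat2) (i j : nat) :
  (i < 2)%nat -> (j < 2)%nat -> entry (adjoint A) i j = Cconj (entry A j i).
Proof. intros Hi Hj. unfold adjoint, entry at 1. now rewrite coeff_mat_bij. Qed.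

Definition cauchy_riemann (D : C -> Prop) (X Y : C -> R) : Prop :=
  forall z, D z -> dv Y z = du X z /\ dv X z = (- du Y z)%R.

(** For F in SU(1,0,1) with diagonal (e^(i theta), e^(- i theta)), the entry
    (0,1) of F E1 F^* is e^(2 i theta) and that of F E2 F^* is i times it, so
    the frame equations give (X + i Y)_v = i (X + i Y)_u. *)
Lemma adapted_frame_cauchy_riemann (D : C -> Prop) (x : C -> L4) (sigma : C -> R)
    (F : C -> mat2) :
  adapted_frame D x sigma F ->
  cauchy_riemann D (fun w => x1 (x w)) (fun w => x2 (x w)).
Proof.
  intros [_ HF] z Dz. destruct (HF z Dz) as ([theta [w ->]] & Hu & Hv).
  apply (f_equal (fun A => entry A 0 1)) in Hu, Hv.
  rewrite entry_mscal, !entry_mmul, !entry_adjoint in Hu, Hv by auto.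
  unfold mmap in Hu, Hv. unfold entry at 1 in Hu. unfold entry at 1 in Hv.
  rewrite coeff_mat_bij in Hu, Hv by auto.
  unfold E1, E2, hermitian, entry, coeff_mat in Hu, Hv. cbn in Hu, Hv.
  assert (Hu1 := f_equal fst Hu). assert (Hu2 := f_equal snd Hu).
  assert (Hv1 := f_equal fst Hv). assert (Hv2 := f_equal snd Hv).
  simpl in Hu1, Hu2, Hv1, Hv2.
  rewrite Hu1, Hu2, Hv1, Hv2. split; ring.
Qed.

Lemma partials_ext (D : C -> Prop) (f f' : C -> R) (z : C) :
  open D -> smooth D f -> (forall w, D w -> f w = f' w) -> D z ->
  du f' z = du f z /\ dv f' z = dv f z.
Proof.
  intros Do Hf Hff Dz. apply pdiff_unique.
  apply (pdiff_ext D f); auto. now apply (smooth_pdiff D).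
Qed.

Lemma du_opp (f : C -> R) (z : C) : du (fun w => (- f w)%R) z = (- du f z)%R.
Proof. apply Derive_opp. Qed.

(** The derivative of a holomorphic function is again holomorphic: here this
    is the symmetry of second partial derivatives. *)
Lemma cauchy_riemann_du (D : C -> Prop) (X Y : C -> R) :
  open D -> smooth D X -> smooth D Y ->
  cauchy_riemann D X Y -> cauchy_riemann D (du X) (du Y).
Proof.
  intros Do SX SY CR z Dz.
  rewrite <- (smooth_schwarz D X), <- (smooth_schwarz D Y) by assumption. split.
  - symmetry. apply (partials_ext D); auto using smooth_dv.
    intros w Dw. now apply CR.
  - rewrite <- du_opp. symmetry. apply (partials_ext D); auto using smooth_dv.
    intros w Dw. now apply CR.
Qed.

Lemma cauchy_riemann_wirtinger (D : C -> Prop) (X Y : C -> R) (z : C) :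
  open D -> smooth D X -> smooth D Y -> cauchy_riemann D X Y -> D z ->
  wirtinger (fun w => (X w, Y w)) z (du X z, du Y z) 0.
Proof.
  intros Do SX SY CR Dz. destruct (CR z Dz) as [CRY CRX].
  split; (eapply pdiff_eq; [apply (smooth_pdiff D); assumption | |]);
    change (fun w => Re (X w, Y w)) with X;
    change (fun w => Im (X w, Y w)) with Y;
    rewrite ?CRX, ?CRY; simpl; ring.
Qed.

(** * The lightlike Gauss map *)

(** The coordinate of a normalised lightlike vector under stereographic
    projection from the null direction of [frakp]; the signs are those that
    make it the function h = conj(h1) + h2 of the representation. *)
Definition gauss_coordinate (y : L4) : C := ((- x1 y)%R, x2 y).

(** The normalisation y3 - y0 = 1 factors out of y3^2 - y0^2, so that the light
    cone equation becomes the linear one y0 + y3 = - (y1^2 + y2^2). *)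
Lemma lightlike_gauss_coordinate (y : L4) :
  lightcone y -> lor y frakp = 1%R ->
  y = Vec4 (- / 2 * (1 + Cmod (gauss_coordinate y) ^ 2))%R
           (- / 2 * (2 * Re (gauss_coordinate y)))%R
           (- / 2 * (- 2 * Im (gauss_coordinate y)))%R
           (- / 2 * (- 1 + Cmod (gauss_coordinate y) ^ 2))%R.
Proof.
  rewrite Cmod2_alt. destruct y as [y0 y1 y2 y3].
  unfold lightcone, lor; simpl. intros Hy Hp.
  assert (E : y3 = (y0 + 1)%R) by lra. subst y3.
  f_equal; nra.
Qed.

(** With (lu, p, q, lu) = x_u and (lv, - q, p, lv) = x_v, the tangent vectors
    under the Cauchy-Riemann equations, the two real orthogonality relations
    are the real and imaginary parts of h phi = l_u - i l_v = 2 l_z. *)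
Lemma gauss_coordinate_mul (y : L4) (p q lu lv : R) :
  lor y frakp = 1%R ->
  lor (Vec4 lu p q lu) y = 0%R -> lor (Vec4 lv (- q)%R p lv) y = 0%R ->
  gauss_coordinate y * (p, q) = (lu, (- lv)%R).
Proof.
  destruct y as [y0 y1 y2 y3]. unfold lor, gauss_coordinate; simpl. intros Hp Hu Hv.
  assert (E : y3 = (y0 + 1)%R) by lra. subst y3.
  apply injective_projections; simpl; lra.
Qed.

(** * The Weierstrass-type representation *)

Theorem theorem3p10 :
  forall (H : R) (D : C -> Prop) (x : C -> L4) (sigma : C -> R) (g : C -> L4),
    H <> 0%R ->
    domain D ->
    simply_connected D ->
    conformal_immersion D x sigma ->
    lightlike_gauss_map D x g ->
    (forall z, D z -> mean_curvature x sigma g z = RtoC H) ->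
    (exists F : C -> mat2, adapted_frame D x sigma F) ->
    exists h1 h2 phi : C -> C,
      let h := fun z => (Cconj (h1 z) + h2 z)%C in
      holomorphic D h1 /\
      meromorphic D h2 /\
      holomorphic D phi /\
      extends_holomorphically D (pole h2) (fun z => (h2 z * h2 z * phi z)%C) /\
      (forall z, D z -> complex_derivative h1 z (RtoC H * phi z)%C) /\
      (forall z0, D z0 ->
        exists U : C -> Prop,
          open U /\ U z0 /\ (forall z, U z -> D z) /\
          forall c dc : R -> C,
            C1_path c dc ->
            (forall t, in_unit t -> U (c t) /\ ~ pole h2 (c t)) ->
            exists J0 J1 J2 : C,
              is_line_integral (fun z => (h z * phi z)%C) c dc J0 /\
              is_line_integral phi c dc J1 /\
              is_line_integral (fun z => (- Ci * phi z)%C) c dc J2 /\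
              (x0 (x (c 1)) - x0 (x (c 0)) = Re J0)%R /\
              (x1 (x (c 1)) - x1 (x (c 0)) = Re J1)%R /\
              (x2 (x (c 1)) - x2 (x (c 0)) = Re J2)%R) /\
      induced_metric D x (fun z => (Cmod (phi z) ^ 2)%R) /\
      (forall z, D z -> ~ pole h2 z ->
        hopf x g z = (/ 2 * (phi z * dz h2 z))%C) /\
      (forall z, D z -> ~ pole h2 z ->
        g z = Vec4 (- / 2 * (1 + Cmod (h z) ^ 2))%R
                   (- / 2 * (2 * Re (h z)))%R
                   (- / 2 * (- 2 * Im (h z)))%R
                   (- / 2 * (- 1 + Cmod (h z) ^ 2))%R).
Proof.
  intros H D x sigma g HH [_ [Do _]] _ (Sx & _ & Iso & _ & Met) (Sg & Gauss) MC [F HF].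
  destruct Sx as (S0 & S1 & S2 & S3). destruct Sg as (_ & G1 & G2 & _).
  set (l := fun w => x0 (x w)) in *.
  set (X := fun w => x1 (x w)) in *.
  set (Y := fun w => x2 (x w)) in *.
  set (l' := fun w => x3 (x w)) in *.
  set (Z := fun w => (X w, Y w) : C).
  set (phi := fun w => (du X w, du Y w) : C).
  set (h := fun w => gauss_coordinate (g w)).
  assert (CR : cauchy_riemann D X Y) by exact (adapted_frame_cauchy_riemann D x sigma F HF).
  assert (El : forall w, D w -> l w = l' w).
  { intros w Dw. generalize (Iso w Dw). unfold isotropic3, lor, l, l'; simpl. lra. }
  assert (Pl : forall w, D w -> du l' w = du l w /\ dv l' w = dv l w).
  { intros w Dw. now apply (partials_ext D). }
  assert (Gp : forall w, D w -> (- x0 (g w) + x3 (g w))%R = 1%R).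
  { intros w Dw. destruct (Gauss w Dw) as (_ & Gp & _). revert Gp.
    unfold lor; simpl. lra. }
  assert (Mphi : forall z, D z -> (Cmod (phi z) ^ 2)%R = exp (2 * sigma z)).
  { intros z Dz. destruct (Met z Dz) as [<- _]. rewrite Cmod2_alt.
    unfold vmap, lor; cbn [x0 x1 x2 x3]. fold l X Y l'.
    rewrite (proj1 (Pl z Dz)). unfold phi; simpl. ring. }
  assert (dzX : forall w, D w -> dz (fun w => RtoC (X w)) w = / 2 * phi w).
  { intros w Dw. rewrite dz_RtoC, (proj2 (CR w Dw)), Ropp_involutive. reflexivity. }
  assert (dzY : forall w, D w -> dz (fun w => RtoC (Y w)) w = / 2 * (- Ci * phi w)).
  { intros w Dw. rewrite dz_RtoC, (proj1 (CR w Dw)). f_equal. unfold phi.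
    apply injective_projections; simpl; ring. }
  assert (dzl : forall w, D w -> dz (fun w => RtoC (l w)) w = / 2 * (h w * phi w)).
  { intros w Dw. rewrite dz_RtoC. f_equal.
    destruct (Gauss w Dw) as (_ & Gw & Hu & Hv). symmetry.
    apply gauss_coordinate_mul; [exact Gw | |].
    - rewrite <- Hu. unfold vmap. fold l X Y l'. now rewrite (proj1 (Pl w Dw)).
    - rewrite <- Hv. unfold vmap. fold l X Y l'.
      now rewrite (proj2 (Pl w Dw)), (proj1 (CR w Dw)), (proj2 (CR w Dw)). }
  assert (dzl' : forall w, D w -> dz (fun w => RtoC (l' w)) w = / 2 * (h w * phi w)).
  { intros w Dw. rewrite <- dzl, !dz_RtoC by assumption.
    now rewrite (proj1 (Pl w Dw)), (proj2 (Pl w Dw)). }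
  set (dphi := fun w => (du (du X) w, du (du Y) w) : C).
  assert (WZ : forall z, D z -> wirtinger Z z (phi z) 0).
  { intros z Dz. now apply (cauchy_riemann_wirtinger D). }
  assert (Wphi : forall z, D z -> wirtinger phi z (dphi z) 0).
  { intros z Dz.
    apply (cauchy_riemann_wirtinger D); auto using smooth_du, cauchy_riemann_du. }
  assert (WH : forall z, D z -> wirtinger h z (dz h z) (dzbar h z)).
  { intros z Dz.
    (* h = - conj (g1 + i g2) *)
    assert (W := smooth_wirtinger D (fun w => (x1 (g w), x2 (g w)) : C) z
      Do (conj G1 G2) Dz).
    apply wirtinger_conj, wirtinger_opp in W.
    apply (wirtinger_ext (fun _ => True) _ h) in W; auto using open_true.
    - now destruct (wirtinger_unique _ _ _ _ W) as [-> ->].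
    - intros w _. apply injective_projections; simpl; ring. }
  assert (WX : forall z, D z ->
    wirtinger (dz (fun w => RtoC (X w))) z (/ 2 * dphi z) 0).
  { intros z Dz. apply (wirtinger_ext D (fun w => / 2 * phi w)); auto.
    { intros; symmetry; auto. }
    eapply wirtinger_eq; [apply wirtinger_scal, Wphi, Dz | reflexivity | ring]. }
  assert (WY : forall z, D z ->
    wirtinger (dz (fun w => RtoC (Y w))) z (/ 2 * (- Ci * dphi z)) 0).
  { intros z Dz. apply (wirtinger_ext D (fun w => / 2 * (- Ci * phi w))); auto.
    { intros; symmetry; auto. }
    eapply wirtinger_eq;
      [apply wirtinger_scal, wirtinger_scal, Wphi, Dz | reflexivity | ring]. }
  assert (Whphi : forall z, D z -> wirtinger (fun w => / 2 * (h w * phi w)) z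
     (/ 2 * (dz h z * phi z + h z * dphi z)) (/ 2 * (dzbar h z * phi z))).
  { intros z Dz.
    eapply wirtinger_eq; [apply wirtinger_scal, wirtinger_mult;
      [apply WH | apply Wphi]; exact Dz | |]; ring. }
  assert (WL : forall z, D z -> wirtinger (dz (fun w => RtoC (l w))) z
     (/ 2 * (dz h z * phi z + h z * dphi z)) (/ 2 * (dzbar h z * phi z))).
  { intros z Dz. apply (wirtinger_ext D (fun w => / 2 * (h w * phi w))); auto.
    intros; symmetry; auto. }
  assert (WL' : forall z, D z -> wirtinger (dz (fun w => RtoC (l' w))) z
     (/ 2 * (dz h z * phi z + h z * dphi z)) (/ 2 * (dzbar h z * phi z))).
  { intros z Dz. apply (wirtinger_ext D (fun w => / 2 * (h w * phi w))); auto.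
    intros; symmetry; auto. }
  (* Constant mean curvature, multiplied by phi conj(phi) = e^(2 sigma). *)
  assert (Hbar : forall z, D z -> dzbar h z = Cconj (H * phi z)).
  { intros z Dz. generalize (MC z Dz). unfold mean_curvature.
    change (vmap dzbar (vmap dz (fun w => toC (x w))) z) with
      (Vec4 (dzbar (dz (fun w => RtoC (l w))) z) (dzbar (dz (fun w => RtoC (X w))) z)
            (dzbar (dz (fun w => RtoC (Y w))) z) (dzbar (dz (fun w => RtoC (l' w))) z)).
    unfold lorC, toC; cbn [x0 x1 x2 x3].
    rewrite (proj2 (wirtinger_unique _ _ _ _ (WL z Dz))),
      (proj2 (wirtinger_unique _ _ _ _ (WL' z Dz))),
      (proj2 (wirtinger_unique _ _ _ _ (WX z Dz))),
      (proj2 (wirtinger_unique _ _ _ _ (WY z Dz))).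
    replace (x3 (g z)) with (1 + x0 (g z))%R by (generalize (Gp z Dz); lra).
    rewrite RtoC_plus. intros E.
    assert (N : RtoC (exp (- 2 * sigma z)) * (phi z * Cconj (phi z)) = 1).
    { rewrite <- Cmod2_conj, Mphi, <- RtoC_mult, <- exp_plus by assumption.
      replace (-2 * sigma z + 2 * sigma z)%R with 0%R by ring. now rewrite exp_0. }
    rewrite Cmult_conj. replace (Cconj H) with (RtoC H)
      by (apply injective_projections; simpl; ring).
    rewrite <- E.
    transitivity (dzbar h z * (RtoC (exp (- 2 * sigma z)) * (phi z * Cconj (phi z)))).
    { rewrite N. ring. }
    field. }
  set (h1 := fun w => H * Z w).
  set (h2 := fun w => h w - Cconj (h1 w)).
  assert (Wh1 : forall z, D z -> wirtinger h1 z (H * phi z) 0).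
  { intros z Dz. eapply wirtinger_eq;
      [apply wirtinger_scal, WZ, Dz | reflexivity | ring]. }
  assert (Wh2 : forall z, D z -> wirtinger h2 z (dz h z) 0).
  { intros z Dz.
    eapply wirtinger_eq; [apply wirtinger_plus; [now apply WH |
      apply wirtinger_opp, wirtinger_conj; now apply Wh1] | |].
    - apply injective_projections; simpl; ring.
    - rewrite Hbar by assumption. ring. }
  assert (Eh : forall w, Cconj (h1 w) + h2 w = h w).
  { intros w. unfold h2. ring. }
  assert (hol : forall f f', (forall z, D z -> wirtinger f z (f' z) 0) -> holomorphic D f).
  { intros f f' Hf z Dz. exists (f' z). apply wirtinger_complex_derivative; auto. }
  exists h1, h2, phi. cbv zeta.
  refine (conj _ (conj _ (conj _ (conj _ (conj _ (conj _ (conj _ (conj _ _)))))))).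
  - now apply (hol _ (fun z => H * phi z)).
  - intros z Dz. left. unfold holomorphic_at. apply (filter_imp D); [|now apply Do].
    now apply (hol _ (dz h)).
  - now apply (hol _ dphi).
  - exists (fun z => h2 z * h2 z * phi z). split; [|reflexivity].
    apply (hol _ (fun z => (dz h z * h2 z + h2 z * dz h z) * phi z
      + h2 z * h2 z * dphi z)).
    intros z Dz.
    eapply wirtinger_eq; [repeat apply wirtinger_mult; auto | |]; cbv beta; ring.
  - intros z Dz. apply wirtinger_complex_derivative; auto.
  - intros z0 Dz0. exists D. repeat split; auto.
    intros c dc Hc HD.
    assert (HD' : forall t, in_unit t -> D (c t)) by (intros t Ht; now apply HD).
    destruct (smooth_line_integral D l (fun z => h z * phi z) c dc) as (J0 & I0 & R0); auto.
    destruct (smooth_line_integral D X phi c dc) as (J1 & I1 & R1); auto.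
    destruct (smooth_line_integral D Y (fun z => - Ci * phi z) c dc) as (J2 & I2 & R2); auto.
    exists J0, J1, J2. repeat split; auto.
    eapply is_RInt_ext; [|exact I0]. intros t _. cbv beta. now rewrite Eh.
  - intros z Dz. rewrite Mphi by assumption. now apply Met.
  - intros z Dz _. rewrite (proj1 (wirtinger_unique _ _ _ _ (Wh2 z Dz))).
    unfold hopf.
    change (vmap dz (vmap dz (fun w => toC (x w))) z) with
      (Vec4 (dz (dz (fun w => RtoC (l w))) z) (dz (dz (fun w => RtoC (X w))) z)
            (dz (dz (fun w => RtoC (Y w))) z) (dz (dz (fun w => RtoC (l' w))) z)).
    unfold lorC, toC; cbn [x0 x1 x2 x3].
    rewrite (proj1 (wirtinger_unique _ _ _ _ (WL z Dz))),
      (proj1 (wirtinger_unique _ _ _ _ (WL' z Dz))),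
      (proj1 (wirtinger_unique _ _ _ _ (WX z Dz))),
      (proj1 (wirtinger_unique _ _ _ _ (WY z Dz))).
    replace (x3 (g z)) with (1 + x0 (g z))%R by (generalize (Gp z Dz); lra).
    rewrite RtoC_plus.
    assert (Ehz : h z = - RtoC (x1 (g z)) + Ci * RtoC (x2 (g z))).
    { apply injective_projections; simpl; ring. }
    rewrite Ehz. ring.
  - intros z Dz _. rewrite Eh. destruct (Gauss z Dz) as (Gl & Gp' & _).
    now apply lightlike_gauss_coordinate.
Qed.
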